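(* Let $a,b\in\mathbb{R}$ with $b>1$, and put $$k_1=\frac{2b\cos a}{1+b^2},\qquad k_2=\frac{2b\sin a}{\sqrt{1-2b^2\cos2a+b^4}}.$$ Then $$\pi=\frac{8b^4}{3\,F_D^{(3)}\!\left(\tfrac52;\tfrac12,\tfrac12,\tfrac12;3\,\Big|\,\dfrac1{b^4},\dfrac{e^{-2ia}}{b^2},\dfrac{e^{2ia}}{b^2}\right)}\Bigg((1+b^2)\,E(k_1)-\frac{b^4+b^2+1}{1+b^2}\,K(k_1)+\frac{b^4-b^2+1}{\sqrt{1-2b^2\cos2a+b^4}}\,K(k_2)-\sqrt{1-2b^2\cos2a+b^4}\;E(k_2)\Bigg).$$
   Context: $K(k)=\int_0^1\frac{dx}{\sqrt{(1-x^2)(1-k^2x^2)}}$ and $E(k)=\int_0^1\sqrt{\frac{1-k^2x^2}{1-x^2}}\,dx$ are the complete elliptic integrals of the first and second kind, as functions of the modulus $k$. The Lauricella function of $n$ variables is $F_D^{(n)}(\alpha;\beta_1,\dots,\beta_n;\gamma\,|\,x_1,\dots,x_n)=\sum_{m_1,\dots,m_n\ge0}\frac{(\alpha)_{m_1+\cdots+m_n}(\beta_1)_{m_1}\cdots(\beta_n)_{m_n}}{(\gamma)_{m_1+\cdots+m_n}\,m_1!\cdots m_n!}x_1^{m_1}\cdots x_n^{m_n}$ for $|x_j|<1$, with $(x)_k$ the Pochhammer symbol. For $\operatorname{Re}\gamma>\operatorname{Re}\alpha>0$ it equals, and outside the region of convergence is defined by analytic continuation through, $\frac{\Gamma(\gamma)}{\Gamma(\alpha)\Gamma(\gamma-\alpha)}\int_0^1\frac{u^{\alpha-1}(1-u)^{\gamma-\alpha-1}}{(1-x_1u)^{\beta_1}\cdots(1-x_nu)^{\beta_n}}\,du$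 (principal branches, $x_j\notin[1,\infty)$). Here $i$ is the imaginary unit. *)

(* Defs.v *)
From mathcomp Require Import all_boot all_order all_algebra finmap complex.
From mathcomp Require Import all_classical all_reals all_analysis.
From mathcomp.analysis.showcase Require summability.

Set Implicit Arguments.
Unset Strict Implicit.
Unset Printing Implicit Defensive.

Import Order.TTheory GRing.Theory Num.Theory.
Import numFieldNormedType.Exports.

Local Open Scope classical_set_scope.
Local Open Scope ring_scope.
Local Open Scope complex_scope.

(* [k] is the modulus, with [|k| < 1] the intended range. At [x = 1] the division
   by zero in both integrands returns [0], which does not affect the Lebesgue
   integral. *)
Definition ellipticK (R : realType) (k : R) : R :=
  \int[lebesgue_measure]_(x in `[0, 1])
    (Num.sqrt ((1 - x ^+ 2) * (1 - k ^+ 2 * x ^+ 2)))^-1.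

Definition ellipticE (R : realType) (k : R) : R :=
  \int[lebesgue_measure]_(x in `[0, 1])
    Num.sqrt ((1 - k ^+ 2 * x ^+ 2) / (1 - x ^+ 2)).

Definition expC (R : realType) (z : R[i]) : R[i] :=
  (expR (complex.Re z))%:C * (cos (complex.Im z) +i* sin (complex.Im z)).

Definition pochhammer (T : pzRingType) (x : T) (k : nat) : T :=
  \prod_(i < k) (x + i%:R).

Definition lauricellaD_term (R : realType) (n : nat)
    (alpha : R[i]) (beta : n.-tuple R[i]) (gamma : R[i]) (x : n.-tuple R[i])
    (m : {ffun 'I_n -> nat}) : R[i] :=
  let N := (\sum_(j < n) m j)%N in
  pochhammer alpha N * (\prod_(j < n) pochhammer (tnth beta j) (m j))
    / (pochhammer gamma N * \prod_(j < n) ((m j)`!)%:R)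
    * \prod_(j < n) tnth x j ^+ m j.

(* The multiple series is summed unconditionally: [summability.sum] is the
   limit of the partial sums over finite sets of multi-indices. It is
   meaningful where the series converges absolutely, in particular when every
   [|x_j| < 1]; no analytic continuation is built in. *)
Definition lauricellaD (R : realType) (n : nat)
    (alpha : R[i]) (beta : n.-tuple R[i]) (gamma : R[i]) (x : n.-tuple R[i]) :
    R[i] :=
  summability.sum (K := R[i]) (R := R[i]^o)
    (lauricellaD_term alpha beta gamma x).

(* Main.v *)
Require Import Defs.
From mathcomp Require Import all_boot all_order all_algebra finmap complex.
From mathcomp Require Import all_classical all_reals all_analysis.
From mathcomp Require Import measurable_realfun.
From mathcomp.analysis.showcase Require summability.
From mathcomp Require Import ring lra.

Set Implicit Arguments.
Unset Strict Implicit.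
Unset Printing Implicit Defensive.

Import Order.TTheory GRing.Theory Num.Theory.
Import numFieldNormedType.Exports.

Local Open Scope ring_scope.
Local Open Scope complex_scope.

(** Write B = b^2, s = sin t, A = sqrt (B^2 - s^2),
V = sqrt (B^2 - 2 B cos(2a) s^2 + s^4), and D for the value of V at s = 1.
Both sides of the formula are reduced to the integral of 2 s^4 / (A V) for t
between 0 and pi/2.

The Lauricella series. Let c_n = (1/2)_n / n!, the Taylor coefficients of
(1 - z)^(-1/2). By Wallis, the integral of sin^(2n) over a quarter period is
pi/2 c_n ([wallis]), and (5/2)_N / (3)_N = c_(N+2) / c_2
([pochhammer_ratio]), so the series is 16/(3 pi) times the integral of
s^4 prod_j (1 - x_j s^2)^(-1/2), expanded termwise. The exchange of sum and
integral is done on the partial sums over the boxes m_j < n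
([lauricellaD_half_box]): there the sum is finite and factorizes into the
truncations S_n(z) of (1 - z)^(-1/2). As c_0 c_n + ... + c_n c_0 = 1, the
product (1 - z) S_n(z)^2 tends to 1 uniformly for |z| <= r < 1
([rsqrt_psum_sqr]). This identifies the limits of S_n(u s^2), for u >= 0, and
of S_n(z s^2) S_n(conj z s^2) = |S_n(z s^2)|^2, in which
only moduli occur. A geometric majorant turns
convergence along the boxes into unconditional summation ([sum_dominated]).
With x = (B^-2, exp(-2ia)/B, exp(2ia)/B) the product of the three factors is
B^2 / (A V).

The elliptic integrals. In terms of s the radicand is (1 - s^2) A^2 V^2, which
as a polynomial in v^2 = (s/b)^2 is reciprocal up to a constant, so the
hyperelliptic integral splits into two elliptic ones in the variables 1/v + v
and 1/v - v. In the normal form of Legendre these are the substitutions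
sin phi = (B+1) s / (B+s^2), which gives the modulus k1, and sin phi = D s / V,
which gives k2. Under them all four complete integrals become integrals over t with the same radicals A
and V ([elliptic_plus_modulus], [elliptic_minus_modulus]). The combination in
the theorem then differs from 2 s^4 / (A V) by the derivative of a function
that vanishes at both ends ([deriv_landen_boundary]). *)

(** * The Taylor coefficients of the inverse square root *)

(** The coefficient of z^n in (1 - z)^(-1/2). *)
Definition rsqrt_coef (K : numFieldType) (n : nat) : K :=
  pochhammer (1 / 2) n / n`!%:R.

Lemma pochhammerS (K : pzRingType) (x : K) n :
  pochhammer x n.+1 = pochhammer x n * (x + n%:R).
Proof. by rewrite /pochhammer big_ord_recr. Qed.

Lemma rsqrt_coef0 (K : numFieldType) : rsqrt_coef K 0 = 1.
Proof. by rewrite /rsqrt_coef /pochhammer big_ord0 fact0 divr1. Qed.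

Lemma rsqrt_coefS (K : numFieldType) n :
  n.+1%:R * rsqrt_coef K n.+1 = (n%:R + 1 / 2) * rsqrt_coef K n.
Proof.
rewrite /rsqrt_coef pochhammerS factS natrM.
have h1 : n.+1%:R != 0 :> K by rewrite pnatr_eq0.
have h2 : n`!%:R != 0 :> K by rewrite pnatr_eq0 -lt0n fact_gt0.
rewrite -[n.+1%:R]natr1 in h1 *.
by field; apply/andP.
Qed.

Lemma rsqrt_coef_gt0 (K : numFieldType) n : 0 < rsqrt_coef K n.
Proof.
apply: divr_gt0; last by rewrite ltr0n fact_gt0.
by apply: prodr_gt0 => i _; rewrite ltr_wpDr ?ler0n // divr_gt0 ?ltr01 ?ltr0n.
Qed.

Lemma rsqrt_coef_ge0 (K : numFieldType) n : 0 <= rsqrt_coef K n.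
Proof. exact/ltW/rsqrt_coef_gt0. Qed.

(** The square of (1 - z)^(-1/2) is the geometric series. With d_n the sum on
the left, pairing i with n - i gives n d_n = 2 sum_i i c_i c_(n-i), and the
recurrence of c turns the right-hand side, at n + 1, into n d_n + d_n. *)
Lemma rsqrt_coef_conv (K : numFieldType) n :
  \sum_(i < n.+1) rsqrt_coef K i * rsqrt_coef K (n - i) = 1.
Proof.
set c := rsqrt_coef K.
elim: n => [|n IHn]; first by rewrite big_ord_recl big_ord0 /c rsqrt_coef0 addr0 mulr1.
have sym m : \sum_(i < m.+1) (m - i)%:R * (c i * c (m - i)%N) =
             \sum_(i < m.+1) i%:R * (c i * c (m - i)%N).
  rewrite (reindex_inj rev_ord_inj) /=; apply: eq_bigr => i _.
  by rewrite subSS subKn ?leq_ord // [c i * _]mulrC.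
have dbl m : m%:R * \sum_(i < m.+1) c i * c (m - i)%N =
             2 * \sum_(i < m.+1) i%:R * (c i * c (m - i)%N).
  rewrite mulr_sumr [2]mulr2n mulrDl mul1r -{2}(sym m) -big_split /=.
  by apply: eq_bigr => i _; rewrite -mulrDl -natrD subnKC ?leq_ord.
have nz : n.+1%:R != 0 :> K by rewrite pnatr_eq0.
apply: (mulfI nz); rewrite dbl big_ord_recl mul0r add0r.
under eq_bigr => i _.
  rewrite lift0 subSS mulrA rsqrt_coefS -mulrA mulrDl; over.
rewrite big_split /= mulrDr -dbl -mulr_sumr IHn.
by rewrite -[n.+1]addn1 natrD; field.
Qed.

Lemma rsqrt_coef_le1 (K : numFieldType) n : rsqrt_coef K n <= 1.
Proof.
rewrite -(rsqrt_coef_conv K n) big_ord_recr /= subnn rsqrt_coef0 mulr1.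
by rewrite lerDr sumr_ge0 // => i _; rewrite mulr_ge0 ?rsqrt_coef_ge0.
Qed.

Definition rsqrt_psum (K : numFieldType) (n : nat) (z : K) : K :=
  \sum_(i < n) rsqrt_coef K i * z ^+ i.

(** The truncation of (1 - z)^(-1/2) squares to a polynomial whose first n
coefficients are 1 and whose other coefficients lie in [0, 1], so it differs
from the truncated geometric series by at most r^n / (1 - r). Bounding the
square makes the estimate purely algebraic and valid for complex z. *)
Lemma rsqrt_psum_sqr (K : numFieldType) (n : nat) (z r : K) :
  `|z| <= r -> r < 1 ->
  `|(1 - z) * rsqrt_psum n z ^+ 2 - 1| <= 3 * r ^+ n / (1 - r).
Proof.
move=> zr r1.
have r0 : 0 <= r by exact: le_trans zr.
have rP : 0 < 1 - r by rewrite subr_gt0.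
pose P := \poly_(i < n) rsqrt_coef K i.
have PE : rsqrt_psum n z = P.[z] by rewrite horner_poly.
have Pcoef k : 0 <= P`_k /\ P`_k <= rsqrt_coef K k.
  by rewrite coef_poly; case: ifP; rewrite ?lexx ?rsqrt_coef_ge0.
have P2_lt k : (k < n)%N -> (P * P)`_k = 1.
  move=> kn; rewrite coefM -(rsqrt_coef_conv K k); apply: eq_bigr => i _.
  have ik : (i <= k)%N by rewrite -ltnS.
  by rewrite !coef_poly (leq_ltn_trans ik kn) (leq_ltn_trans (leq_subr _ _) kn).
have P2_bound k : `|(P * P)`_k| <= 1.
  rewrite coefM ger0_norm; last first.
    apply: sumr_ge0 => i _.
    by apply: mulr_ge0; [case: (Pcoef i)|case: (Pcoef (k - i)%N)].
  rewrite -(rsqrt_coef_conv K k); apply: ler_sum => i _.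
  by apply: ler_pM; case: (Pcoef i); case: (Pcoef (k - i)%N).
have P2size : (size (P * P)%R <= n + n)%N.
  apply: leq_trans (size_polyMleq _ _) _.
  apply: leq_trans (leq_pred _) _.
  by rewrite leq_add // size_poly.
rewrite PE expr2 -hornerM (horner_coef_wide _ P2size) big_split_ord /=.
under eq_bigr => i _ do rewrite P2_lt // mul1r.
have powE : (1 - z) * \sum_(i < n) z ^+ i = 1 - z ^+ n.
  by rewrite -[RHS]opprB subrX1 -mulNr opprB.
rewrite mulrDr powE addrAC [1 - _]addrC addrK.
have geoE : \sum_(i < n) r ^+ i = (1 - r ^+ n) / (1 - r).
  apply/(mulIf (lt0r_neq0 rP)); rewrite divfK ?gt_eqF // -[RHS]opprB subrX1.
  by rewrite -mulNr opprB mulrC.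
have tail :
    `|\sum_(i < n) (P * P)`_(rshift n i) * z ^+ rshift n i| <= r ^+ n / (1 - r).
  apply: le_trans (ler_norm_sum _ _ _) _.
  apply: (@le_trans _ _ (\sum_(i < n) r ^+ n * r ^+ i)).
    apply: ler_sum => i _; rewrite normrM normrX -exprD -[leRHS]mul1r.
    by apply: ler_pM => //; rewrite ?exprn_ge0 // lerXn2r ?nnegrE.
  rewrite -mulr_sumr geoE mulrA ler_pM2r ?invr_gt0 // -[leRHS]mulr1.
  by rewrite ler_wpM2l ?exprn_ge0 // gerBl exprn_ge0.
apply: le_trans (ler_normD _ _) _.
rewrite normrN normrX normrM.
have -> : 3 * r ^+ n / (1 - r) = r ^+ n / (1 - r) + 2 * (r ^+ n / (1 - r)).
  by field; rewrite gt_eqF.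
apply: lerD.
  apply: (@le_trans _ _ (r ^+ n)); first by rewrite lerXn2r ?nnegrE.
  by rewrite ler_peMr ?exprn_ge0 // invf_ge1 // gerBl.
apply: ler_pM => //; apply: le_trans (ler_normB _ _) _.
by rewrite normr1 -[2]/(1 + 1) lerD2l (le_trans zr) // ltW.
Qed.

(** * Continuity and derivatives of elementary expressions *)

Section Calculus.
Variable R : realType.
Implicit Types (f g : R -> R) (x df dg : R).

Lemma cont_add f g : continuous f -> continuous g ->
  continuous (fun x => f x + g x).
Proof. by move=> cf cg x; exact: cvgD (cf x) (cg x). Qed.

Lemma cont_opp f : continuous f -> continuous (fun x => - f x).
Proof. by move=> cf x; exact: cvgN (cf x). Qed.

Lemma cont_mul f g : continuous f -> continuous g ->
  continuous (fun x => f x * g x).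
Proof. by move=> cf cg x; exact: cvgM (cf x) (cg x). Qed.

Lemma cont_exp f n : continuous f -> continuous (fun x => f x ^+ n).
Proof.
by move=> cf x; apply: (@continuous_comp _ _ _ f (fun y => y ^+ n));
  [exact: cf|exact: exprn_continuous].
Qed.

Lemma cont_inv f : (forall x, f x != 0) -> continuous f ->
  continuous (fun x => (f x)^-1).
Proof. by move=> f0 cf x; exact: cvgV (f0 x) (cf x). Qed.

Lemma cont_sqrt f : continuous f -> continuous (fun x => Num.sqrt (f x)).
Proof.
by move=> cf x; apply: (@continuous_comp _ _ _ f Num.sqrt);
  [exact: cf|exact: sqrt_continuous].
Qed.

Lemma cont_cst (c : R) : continuous (fun _ : R => c).
Proof. by move=> x; exact: cvg_cst. Qed.

Lemma cont_sum (I : finType) (F : I -> R -> R) : (forall i, continuous (F i)) ->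
  continuous (fun x => \sum_i F i x).
Proof.
move=> cF; apply: (@continuous_big _ _ +%R 0 xpredT) => // x; exact: add_continuous.
Qed.

(** A synonym of [is_derive] that is not a class, so that the rules below, and
not instance resolution, determine the form of the derivative. *)
Definition deriv_at f x df : Prop := is_derive x 1 f df.

Lemma deriv_at_eq f x df df' : deriv_at f x df -> df = df' -> is_derive x 1 f df'.
Proof. by move=> Df <-. Qed.

Lemma deriv_cst (c x : R) : deriv_at (fun _ => c) x 0.
Proof. exact: is_derive_cst. Qed.

Lemma deriv_sin x : deriv_at sin x (cos x).
Proof. exact: is_derive_sin. Qed.

Lemma deriv_cos x : deriv_at cos x (- sin x).
Proof. exact: is_derive_cos. Qed.

Lemma deriv_add f g x df dg : deriv_at f x df -> deriv_at g x dg ->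
  deriv_at (fun y => f y + g y) x (df + dg).
Proof. by move=> Df Dg; exact: is_deriveD. Qed.

Lemma deriv_opp f x df : deriv_at f x df -> deriv_at (fun y => - f y) x (- df).
Proof. by move=> Df; exact: is_deriveN. Qed.

Lemma deriv_mul f g x df dg : deriv_at f x df -> deriv_at g x dg ->
  deriv_at (fun y => f y * g y) x (f x * dg + g x * df).
Proof. by move=> Df Dg; exact: is_deriveM. Qed.

Lemma deriv_exp f n x df : deriv_at f x df ->
  deriv_at (fun y => f y ^+ n.+1) x (n.+1%:R * f x ^+ n * df).
Proof.
rewrite /deriv_at => Df; elim: n => [|n IHn].
  by rewrite expr0 !mul1r; under eq_fun do rewrite expr1.
under eq_fun do rewrite exprS.
apply: is_derive_eq; rewrite /GRing.scale /=.
by rewrite exprS -[n.+2]addn1 natrD; ring.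
Qed.

Lemma deriv_inv f x df : f x != 0 -> deriv_at f x df ->
  deriv_at (fun y => (f y)^-1) x (- (f x) ^- 2 * df).
Proof. by move=> f0 Df; exact: is_deriveV. Qed.

Lemma deriv_sqrt f x df : 0 < f x -> deriv_at f x df ->
  deriv_at (fun y => Num.sqrt (f y)) x ((2 * Num.sqrt (f x))^-1 * df).
Proof.
move=> f0 Df; apply: (@is_derive1_comp _ Num.sqrt f); first exact: is_derive1_sqrt.
exact: Df.
Qed.

End Calculus.

Ltac prove_cont := repeat
  match goal with
  | H : ?T |- ?T => exact: H
  | |- forall x, continuous_at x ?F =>
    lazymatch F with
    | (fun y => @?f y + @?g y) => apply: (@cont_add _ f g)
    | (fun y => - @?f y) => apply: (@cont_opp _ f)
    | (fun y => @?f y * @?g y) => apply: (@cont_mul _ f g)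
    | (fun y => @?f y ^+ ?n) => apply: (@cont_exp _ f n)
    | (fun y => (@?f y)^-1) => apply: (@cont_inv _ f)
    | (fun y => Num.sqrt (@?f y)) => apply: (@cont_sqrt _ f)
    | (fun _ => ?c) => apply: (@cont_cst _ c)
    | _ => first [ assumption | exact: continuous_sin | exact: continuous_cos ]
    end
  end.

Ltac prove_deriv := repeat
  lazymatch goal with
  | |- deriv_at ?F _ _ =>
    lazymatch F with
    | (fun y => @?f y + @?g y) => apply: (@deriv_add _ f g)
    | (fun y => - @?f y) => apply: (@deriv_opp _ f)
    | (fun y => @?f y * @?g y) => apply: (@deriv_mul _ f g)
    | (fun y => @?f y ^+ S ?n) => apply: (@deriv_exp _ f n)
    | (fun y => (@?f y)^-1) => apply: (@deriv_inv _ f)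
    | (fun y => Num.sqrt (@?f y)) => apply: (@deriv_sqrt _ f)
    | (fun _ => ?c) => apply: (@deriv_cst _ c)
    | _ => first [ exact: deriv_sin | exact: deriv_cos ]
    end
  end.

(** * Integrals over a quarter period *)

Definition qint {R : realType} (f : R -> R) : R :=
  \int[lebesgue_measure]_(x in `[0, pi / 2]%classic) f x.

Section QuarterPeriodIntegral.
Variable R : realType.
Implicit Types f g F : R -> R.

Lemma qint_integrable f : continuous f ->
  (@lebesgue_measure R).-integrable `[0, pi / 2]%classic (EFin \o f).
Proof.
move=> cf; apply: continuous_compact_integrable; first exact: segment_compact.
exact: continuous_subspaceT.
Qed.

Lemma qintD f g : continuous f -> continuous g ->
  qint (fun x => f x + g x) = qint f + qint g.
Proof. by move=> cf cg; rewrite /qint RintegralD //; exact: qint_integrable. Qed.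

Lemma qintB f g : continuous f -> continuous g ->
  qint (fun x => f x - g x) = qint f - qint g.
Proof. by move=> cf cg; rewrite /qint RintegralB //; exact: qint_integrable. Qed.

Lemma qintZ (c : R) f : continuous f -> qint (fun x => c * f x) = c * qint f.
Proof. by move=> cf; rewrite /qint RintegralZl //; exact: qint_integrable. Qed.

Lemma qint_sum (I : finType) (F : I -> R -> R) : (forall i, continuous (F i)) ->
  qint (fun x => \sum_i F i x) = \sum_i qint (F i).
Proof.
move=> cF; have cs s : continuous (fun x => \sum_(i <- s) F i x).
  by apply: (@continuous_big _ _ +%R 0 xpredT) => // x; exact: add_continuous.
elim: (index_enum I) => [|i s IHs].
  rewrite big_nil /qint (_ : (fun _ => _) = cst 0) ?Rintegral_cst ?mul0r //.
  by apply/funext => x; rewrite big_nil.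
rewrite big_cons -IHs -qintD //.
by apply: eq_Rintegral => x _; rewrite big_cons.
Qed.

Lemma qint_cst (c : R) : qint (cst c) = c * (pi / 2).
Proof.
rewrite /qint Rintegral_cst //= lebesgue_measure_itv /= lte_fin.
by rewrite divr_gt0 ?(pi_gt0 R) //= subr0.
Qed.

Lemma qint_dist f g (e : R) : continuous f -> continuous g ->
  (forall x, `|f x - g x| <= e) -> `|qint f - qint g| <= e * (pi / 2).
Proof.
move=> cf cg fge; rewrite -qintB // -qint_cst.
have cfg : continuous (fun x => f x - g x) by move=> x; exact: cvgB (cf x) (cg x).
apply: le_trans (le_normr_Rintegral _ _) _ => //; first exact: qint_integrable.
apply: le_Rintegral => //.
  by apply: qint_integrable => x; apply: cvg_norm; exact: cfg.
by apply: qint_integrable => x; exact: cvg_cst.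
Qed.

Lemma qint_derive F f : (forall x : R, is_derive x 1 F (f x)) -> continuous f ->
  qint f = F (pi / 2) - F 0.
Proof.
move=> dF cf; rewrite /qint /Rintegral.
have cF : continuous F.
  by move=> x; apply/differentiable_continuous/derivable1_diffP; case: (dF x).
rewrite (@continuous_FTC2 _ f F) //.
- by rewrite divr_gt0 ?(pi_gt0 R).
- exact: continuous_subspaceT.
- split => [x _| |]; first by case: (dF x).
  + by apply: cvg_at_right_filter; exact: cF.
  + by apply: cvg_at_left_filter; exact: cF.
- by move=> x _; rewrite derive1E; case: (dF x).
Qed.

End QuarterPeriodIntegral.

(** The function - cos sin^(2n+1) vanishes at both ends of the quarter period,
and the integral of its derivative gives the recurrence of the coefficients. *)
Lemma wallis (R : realType) n :
  qint (fun x : R => sin x ^+ (2 * n)) = (pi / 2) * rsqrt_coef R n.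
Proof.
elim: n => [|n IHn].
  by rewrite (_ : (fun _ => _) = cst 1) ?qint_cst ?rsqrt_coef0 ?mul1r ?mulr1 //;
    apply/funext => x; rewrite muln0 expr0.
pose G (x : R) := - (cos x * sin x ^+ (2 * n).+1).
have dG (x : R) : is_derive x 1 G
    (2 * n.+1%:R * sin x ^+ (2 * n.+1) - (2 * n).+1%:R * sin x ^+ (2 * n)).
  apply: deriv_at_eq; first by rewrite /G; prove_deriv.
  have c2 := sin2cos2 x.
  rewrite mulnS exprD exprS; ring : c2.
have := qint_derive dG.
rewrite /G cos_pihalf mul0r sin0 expr0n /= mulr0 oppr0 subr0.
rewrite qintB ?qintZ; try by prove_cont.
move=> /(_ ltac:(prove_cont)); rewrite IHn => /subr0_eq recq.
have nz : 2 * n.+1%:R != 0 :> R by rewrite mulf_neq0 ?pnatr_eq0.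
apply: (mulfI nz); rewrite recq.
transitivity (pi * (n.+1%:R * rsqrt_coef R n.+1)); last by field.
by rewrite rsqrt_coefS; field.
Qed.

(** * Unconditional sums *)

Lemma big_fsubset (I : choiceType) (V : nmodType) (F : I -> V) (A B : {fset I}) :
  (A `<=` B)%fset -> \sum_(i <- A) F i = \sum_(i <- B | i \in A) F i.
Proof.
move=> /fsubsetP AB; rewrite -[RHS]big_filter.
apply: perm_big; apply: uniq_perm.
- exact: fset_uniq.
- by rewrite filter_uniq // fset_uniq.
- by move=> i; rewrite mem_filter; case: (boolP (i \in A)) => //= /AB ->.
Qed.

(** Convergence along one exhausting sequence of finite sets decides the
unconditional sum when the terms have a majorant g whose sums over these sets
converge: a finite set between B N and some B n adds at most the sum of g over
B n minus that over B N, which is small by the Cauchy criterion. *)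
Lemma sum_dominated (R : realType) (I : choiceType) (x : I -> R[i]) (g : I -> R)
    (B : nat -> {fset I}) (G : R) (L : R[i]) :
  (forall i, `|x i| <= (g i)%:C) ->
  (forall A, exists N, forall n, (N <= n)%N -> (A `<=` B n)%fset) ->
  ((\sum_(i <- B n) g i) @[n --> \oo] --> G)%classic ->
  (forall e : R, 0 < e ->
     exists N, forall n, (N <= n)%N -> `|L - \sum_(i <- B n) x i| <= e%:C) ->
  summability.sum (K := R[i]) (R := R[i]^o) x = L.
Proof.
move=> xg Bcov gG xL.
have g0 i : 0 <= g i by rewrite -(lecR 0); apply: le_trans (xg i); exact: normr_ge0.
have FF := @summability.totally_filter I.
apply: cvg_lim => //.
apply/(@cvgrPdist_le R[i] R[i]^o) => /= e e0.
have [d dE d0] : exists2 d : R, e = d%:C & 0 < d.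
  case: e e0 => d d1; rewrite ltcE /= => /andP[/eqP -> d0].
  by exists d.
have d3 : 0 < d / 3 by rewrite divr_gt0.
move/cvgrPdist_le : gG => /(_ _ d3)[N1 _ HN1].
have [N2 HN2] := xL _ d3.
pose N := maxn N1 N2.
exists (B N) => // A /= BA.
have [N3 HN3] := Bcov A.
pose n := maxn N N3.
have An : (A `<=` B n)%fset by apply: HN3; rewrite leq_maxr.
have Bn : (B N `<=` B n)%fset by apply: fsubset_trans An.
have -> : summability.partial_sum x A = \sum_(i <- A) x i.
  by rewrite /summability.partial_sum big_seq_fsetE.
have split_sum (V : zmodType) (F : I -> V) :
    \sum_(i <- A) F i = \sum_(i <- B N) F i + \sum_(i <- A | i \notin B N) F i.
  by rewrite (big_fsubset F BA) [LHS](bigID [in B N]).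
have tail_le : \sum_(i <- A | i \notin B N) g i <= d / 3 + d / 3.
  have -> : \sum_(i <- A | i \notin B N) g i =
            \sum_(i <- A) g i - \sum_(i <- B N) g i by rewrite split_sum addrC addKr.
  have AgBn : \sum_(i <- A) g i <= \sum_(i <- B n) g i.
    rewrite (big_fsubset _ An) [leRHS](bigID [in A]) /= lerDl.
    by apply: sumr_ge0.
  have := HN1 N (leq_maxl _ _); have := HN1 n; rewrite /= !ler_norml.
  rewrite /n (leq_trans _ (leq_maxl _ _)) ?leq_maxl //.
  move=> /(_ isT) /andP[h1 _] /andP[_ h2].
  by move: h1 h2 AgBn; rewrite -/n; lra.
rewrite split_sum opprD addrA dE.
have -> : d = d / 3 + (d / 3 + d / 3) by field.
rewrite rmorphD /=; apply: le_trans (ler_normB _ _) _; apply: lerD.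
  by apply: HN2; rewrite leq_maxr.
apply: le_trans (ler_norm_sum _ _ _) _.
apply: (@le_trans _ _ (\sum_(i <- A | i \notin B N) (g i)%:C)).
  by apply: ler_sum => i _; exact: xg.
by rewrite -rmorph_sum lecR.
Qed.

(** * Lauricella series with all parameters beta equal to one half *)

Definition cqint (R : realType) (f : R -> R[i]) : R[i] :=
  qint (fun x => complex.Re (f x)) +i* qint (fun x => complex.Im (f x)).

Lemma cqint_real (R : realType) (f : R -> R) :
  cqint (fun x => (f x)%:C) = (qint f)%:C.
Proof.
by apply/eqP; rewrite eq_complex /= eqxx /= -/(cst 0) qint_cst mul0r.
Qed.

Lemma cqint_sum (R : realType) (I : finType) (a : I -> R[i]) (g : I -> R -> R) :
  (forall i, continuous (g i)) ->
  cqint (fun x => \sum_i a i * (g i x)%:C) = \sum_i a i * (qint (g i))%:C.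
Proof.
move=> cg.
have ReM (z : R[i]) (t : R) : complex.Re (z * t%:C) = complex.Re z * t.
  by case: z => u v /=; rewrite mulr0 subr0.
have ImM (z : R[i]) (t : R) : complex.Im (z * t%:C) = complex.Im z * t.
  by case: z => u v /=; rewrite mulr0 add0r.
apply/eqP; rewrite eq_complex /= !raddf_sum /=; apply/andP; split; apply/eqP.
- rewrite -[RHS](_ : \sum_i qint (fun x => complex.Re (a i) * g i x) = _); last first.
    by apply: eq_bigr => i _; rewrite qintZ // ReM.
  rewrite -qint_sum; last by move=> i; prove_cont.
  congr qint; apply/funext => x; rewrite raddf_sum /=.
  by apply: eq_bigr => i _; rewrite ReM.
- rewrite -[RHS](_ : \sum_i qint (fun x => complex.Im (a i) * g i x) = _); last first.
    by apply: eq_bigr => i _; rewrite qintZ // ImM.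
  rewrite -qint_sum; last by move=> i; prove_cont.
  congr qint; apply/funext => x; rewrite raddf_sum /=.
  by apply: eq_bigr => i _; rewrite ImM.
Qed.

Definition multi_box (n m : nat) : {fset {ffun 'I_n -> nat}} :=
  [fset ([ffun j => val (f j)] : {ffun 'I_n -> nat})
     | f : {ffun 'I_n -> 'I_m} in enum {: {ffun 'I_n -> 'I_m}}]%fset.

Lemma big_multi_box (V : nmodType) n m (F : {ffun 'I_n -> nat} -> V) :
  \sum_(i <- multi_box n m) F i =
  \sum_(f : {ffun 'I_n -> 'I_m}) F [ffun j => val (f j)].
Proof.
pose emb (f : {ffun 'I_n -> 'I_m}) : {ffun 'I_n -> nat} := [ffun j => val (f j)].
have embI : injective emb.
  move=> f g /ffunP fg; apply/ffunP => j; apply/val_inj.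
  by have := fg j; rewrite !ffunE.
rewrite -[RHS]big_enum -(big_map emb xpredT F) /=; apply: perm_big.
apply: uniq_perm; first exact: fset_uniq.
  by rewrite map_inj_uniq // enum_uniq.
by move=> i; apply/imfsetP/mapP => -[f fE ->]; exists f.
Qed.

Lemma multi_box_exhausts n (A : {fset {ffun 'I_n -> nat}}) :
  exists N, forall m, (N <= m)%N -> (A `<=` multi_box n m)%fset.
Proof.
(* One more than the sum of all entries bounds each of them strictly. *)
exists (\sum_(f <- A) \sum_j f j).+1 => m Am; apply/fsubsetP => f fA.
have fm j : (f j < m)%N.
  apply: leq_ltn_trans Am; rewrite (big_fsetD1 f fA) /= (bigD1 j) //=.
  by rewrite -addnA leq_addr.
apply/imfsetP; exists ([ffun j => Ordinal (fm j)] : {ffun 'I_n -> 'I_m}).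
  exact: mem_enum.
by apply/ffunP => j; rewrite !ffunE.
Qed.

Lemma rsqrt_coefC (R : realType) n : rsqrt_coef R[i] n = (rsqrt_coef R n)%:C.
Proof.
rewrite /rsqrt_coef [RHS]fmorph_div /= rmorph_nat; congr (_ / _).
rewrite /pochhammer rmorph_prod; apply: eq_bigr => i _.
by rewrite rmorphD /= fmorph_div /= !rmorph_nat rmorph1.
Qed.

(** The left-hand side is the moment of order N of a beta distribution; for
these half-integral parameters it is a quotient of two Wallis integrals. *)
Lemma pochhammer_ratio (K : numFieldType) k N :
  pochhammer (1 / 2 + k%:R : K) N / pochhammer (1 + k%:R) N =
  rsqrt_coef K (N + k) / rsqrt_coef K k.
Proof.
have ck := lt0r_neq0 (rsqrt_coef_gt0 K k).
elim: N => [|N IHN]; first by rewrite /pochhammer !big_ord0 add0n !divff ?oner_eq0.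
have Nk0 : (N + k).+1%:R != 0 :> K by rewrite pnatr_eq0.
have -> : rsqrt_coef K (N.+1 + k) =
    ((N + k)%:R + 1 / 2) / (N + k).+1%:R * rsqrt_coef K (N + k).
  by rewrite mulrAC -rsqrt_coefS [_ * rsqrt_coef _ _]mulrC mulfK.
rewrite !pochhammerS -mulf_div IHN -[1 + k%:R + _](_ : (N + k).+1%:R = _).
  by rewrite mulrC -!mulrA natrD; congr (_ * _); ring.
by rewrite -natr1 natrD; ring.
Qed.

Lemma lauricellaD_half_term (R : realType) n k (beta x : n.-tuple R[i])
    (m : {ffun 'I_n -> nat}) :
  (forall j, tnth beta j = 1 / 2) ->
  lauricellaD_term (1 / 2 + k%:R) beta (1 + k%:R) x m =
  (\prod_j (rsqrt_coef R[i] (m j) * tnth x j ^+ m j)) *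
  (2 / (pi * rsqrt_coef R k) *
   qint (fun t : R => sin t ^+ (2 * (\sum_j m j + k))))%:C.
Proof.
move=> hb; rewrite wallis /lauricellaD_term.
rewrite -mulf_div pochhammer_ratio !rsqrt_coefC -fmorph_div /=.
rewrite mulrC [X in _ * X]mulrC mulrA; congr (_ * real_complex R _); last first.
  have := lt0r_neq0 (pi_gt0 R); have ck := lt0r_neq0 (rsqrt_coef_gt0 R k).
  by move: (pi) => p p0; field; apply/andP.
rewrite -prodf_div mulrC -big_split; apply: eq_bigr => j _ /=.
by rewrite hb.
Qed.

Lemma big_multi_box_prod (K : comPzRingType) n m (G : 'I_n -> nat -> K) :
  \sum_(f <- multi_box n m) \prod_j G j (f j) = \prod_j \sum_(i < m) G j i.
Proof.
rewrite big_multi_box bigA_distr_bigA; apply: eq_bigr => f _.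
by apply: eq_bigr => j _; rewrite ffunE.
Qed.

(** On a box the multiple sum is finite and factorizes, so that the sum and the
integral representing the Pochhammer quotient can be exchanged. *)
Lemma lauricellaD_half_box (R : realType) n k m (beta x : n.-tuple R[i]) :
  (forall j, tnth beta j = 1 / 2) ->
  \sum_(f <- multi_box n m)
     lauricellaD_term (1 / 2 + k%:R) beta (1 + k%:R) x f =
  (2 / (pi * rsqrt_coef R k))%:C *
  cqint (fun t : R => (sin t ^+ (2 * k))%:C *
     \prod_j rsqrt_psum m (tnth x j * (sin t ^+ 2)%:C)).
Proof.
move=> hb; rewrite big_multi_box.
pose a (f : {ffun 'I_n -> 'I_m}) :=
  \prod_j (rsqrt_coef R[i] (f j) * tnth x j ^+ f j).
pose N (f : {ffun 'I_n -> 'I_m}) := (\sum_j f j)%N.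
transitivity (\sum_f (2 / (pi * rsqrt_coef R k))%:C *
    (a f * (qint (fun t : R => sin t ^+ (2 * (N f + k))))%:C)).
  apply: eq_bigr => f _; rewrite lauricellaD_half_term // rmorphM mulrCA.
  congr (_ * (_ * _)); first by apply: eq_bigr => j _; rewrite ffunE.
  by rewrite (eq_bigr (fun j => f j : nat)) // => j _; rewrite ffunE.
rewrite -mulr_sumr -cqint_sum; last by move=> f; prove_cont.
congr (_ * cqint _); apply/funext => t.
rewrite bigA_distr_bigA mulr_sumr; apply: eq_bigr => f _.
rewrite mulnDr exprD rmorphM [RHS]mulrC mulrA; congr (_ * _).
under [RHS]eq_bigr do rewrite exprMn mulrA.
rewrite big_split /=; congr (_ * _).
rewrite exprM /N -prodrXr rmorph_prod; apply: eq_bigr => j _.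
by rewrite rmorphXn.
Qed.

(** Since c_(N+k) <= 1 and c_i <= 1, a multiple of r^(m_1 + ... + m_n)
dominates the terms; its sums over boxes are powers of geometric sums. *)
Lemma lauricellaD_half_lim (R : realType) n k (beta x : n.-tuple R[i])
    (r : R) (L : R[i]) :
  (forall j, tnth beta j = 1 / 2) ->
  0 <= r < 1 -> (forall j, `|tnth x j| <= r%:C) ->
  (forall e : R, 0 < e -> exists M, forall m, (M <= m)%N ->
     `|L - (2 / (pi * rsqrt_coef R k))%:C *
       cqint (fun t : R => (sin t ^+ (2 * k))%:C *
         \prod_j rsqrt_psum m (tnth x j * (sin t ^+ 2)%:C))| <= e%:C) ->
  lauricellaD (1 / 2 + k%:R) beta (1 + k%:R) x = L.
Proof.
move=> hb /andP[r0 r1] xr HL.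
have ck := rsqrt_coef_gt0 R k.
pose g (m : {ffun 'I_n -> nat}) : R := (rsqrt_coef R k)^-1 * \prod_j r ^+ m j.
apply: (@sum_dominated _ _ _ g (multi_box n)
  ((rsqrt_coef R k)^-1 * \prod_(j < n) (1 - r)^-1)).
- move=> m; rewrite lauricellaD_half_term // wallis.
  have -> : 2 / (pi * rsqrt_coef R k) * (pi / 2 * rsqrt_coef R (\sum_j m j + k)) =
            (rsqrt_coef R k)^-1 * rsqrt_coef R (\sum_j m j + k).
    by have := pi_gt0 R; move: (pi) => p p0; field; rewrite !lt0r_neq0.
  rewrite normrM mulrC /g [leRHS]rmorphM /=; apply: ler_pM => //.
    rewrite ger0_norm; last by rewrite ler0c mulr_ge0 ?invr_ge0 ?rsqrt_coef_ge0.
    by rewrite lecR ler_piMr ?rsqrt_coef_le1 // invr_ge0 ltW.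
  rewrite normr_prod rmorph_prod; apply: ler_prod => j _; rewrite normr_ge0 /=.
  rewrite normrM normrX ger0_norm ?rsqrt_coef_ge0 // -[leRHS]mul1r rmorphXn /=.
  rewrite ler_pM ?rsqrt_coef_ge0 ?exprn_ge0 ?rsqrt_coef_le1 //.
  by rewrite lerXn2r ?nnegrE // ler0c.
- exact: multi_box_exhausts.
- have -> : (fun m => \sum_(f <- multi_box n m) g f) =
    (fun m => (rsqrt_coef R k)^-1 * \prod_(j < n) \sum_(i < m) r ^+ i).
    apply/funext => m; rewrite /g -mulr_sumr.
    by rewrite (big_multi_box_prod m (fun _ i => r ^+ i)).
  apply: cvgMl_tmp; apply: (@cvg_big R _ *%R 1 xpredT); first exact: mul_continuous.
  move=> j _.
  have := @cvg_geometric_series R 1 r; rewrite ger0_norm // mul1r => /(_ r1).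
  apply: cvg_trans; apply: near_eq_cvg; near=> m.
  by rewrite /series /= big_mkord; apply: eq_bigr => i _; rewrite mul1r.
- by move=> e e0; have [M HM] := HL e e0; exists M => m /HM; rewrite lauricellaD_half_box.
Unshelve. all: by end_near. Qed.

Lemma sqr_normc_real (R : realType) (z : R[i]) :
  `|z| ^+ 2 = (complex.Re (`|z| ^+ 2))%:C.
Proof. by rewrite normc_def -rmorphXn. Qed.

(** If (1 - w) S(w)^2 is within d of 1, then so is sqrt(1 - u) S(u) for real
u >= 0, because S(u) >= 0 and |p - 1| <= |p^2 - 1| for p >= 0; for complex z
the modulus |1 - z| |S(z)|^2 is within d of 1 as well. Both denominators are
at least 1 - r, which gives a bound for the product. *)
Lemma rsqrt_psum_approx (R : realType) m (u r d : R) (z : R[i]) :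
  0 <= u <= r -> `|z| <= r%:C -> r < 1 -> 3 * r ^+ m / (1 - r) <= d -> d <= 1 ->
  `|rsqrt_psum m u * complex.Re (`|rsqrt_psum m z| ^+ 2)
    - (Num.sqrt (1 - u) * complex.Re `|1 - z|)^-1| <= 3 * d / (1 - r) ^+ 2.
Proof.
move=> /andP[u0 ur] zr r1 md d1.
have r0 : 0 <= r by exact: le_trans ur.
have s0 : 0 < 1 - r by rewrite subr_gt0.
pose P := rsqrt_psum m u.
have P0 : 0 <= P.
  by apply: sumr_ge0 => i _; rewrite mulr_ge0 ?rsqrt_coef_ge0 // exprn_ge0.
pose p := Num.sqrt (1 - u) * P.
have p0 : 0 <= p by rewrite mulr_ge0 // sqrtr_ge0.
have u1 : 1 - r <= 1 - u by rewrite lerD2l lerN2.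
have pB : `|p - 1| <= d.
  have : `|(1 - u) * P ^+ 2 - 1| <= d.
    by apply: le_trans md; apply: rsqrt_psum_sqr => //; rewrite ger0_norm.
  have -> : (1 - u) * P ^+ 2 - 1 = (p - 1) * (p + 1).
    rewrite -subr_sqr_1 /p exprMn sqr_sqrtr // (le_trans _ u1) // ltW //.
  rewrite normrM; apply: le_trans; rewrite ler_peMr // ger0_norm; last by rewrite addr_ge0.
  by rewrite lerDr.
pose Q := complex.Re (`|rsqrt_psum m z| ^+ 2).
pose h := complex.Re `|1 - z|.
have hE : `|1 - z| = h%:C by rewrite /h normc_def.
have QE : `|rsqrt_psum m z| ^+ 2 = Q%:C by exact: sqr_normc_real.
have h1 : 1 - r <= h.
  have := lerB_dist 1 z; rewrite normr1 hE => h1.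
  rewrite -lecR; apply: le_trans h1; rewrite rmorphB /=.
  by rewrite lerD2l lerN2.
pose q := h * Q.
have qB : `|q - 1| <= d.
  have Z : `|(1 - z) * rsqrt_psum m z ^+ 2 - 1| <= d%:C.
    have rc1 : r%:C < 1 by rewrite -[1]/(1%:C) ltcR.
    apply: le_trans (rsqrt_psum_sqr m zr rc1) _.
    have -> : 3 * r%:C ^+ m / (1 - r%:C) = (3 * r ^+ m / (1 - r))%:C.
      by rewrite fmorph_div rmorphM rmorphXn rmorphB rmorph_nat rmorph1.
    by rewrite lecR.
  have := le_trans (ler_dist_dist _ _) Z.
  rewrite normr1 normrM normrX hE QE -rmorphM -[1]/(1%:C) -rmorphB /=.
  by rewrite normc_def /= expr0n addr0 sqrtr_sqr lecR.
rewrite -/P -/Q -/h; set S := Num.sqrt (1 - u).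
have S1 : 1 - r <= S.
  rewrite -(gtr0_norm s0) -sqrtr_sqr; apply: ler_wsqrtr.
  by apply: le_trans u1; rewrite expr2 ger_pMl // gerBl.
have S0 : 0 < S by exact: lt_le_trans S1.
have h0 : 0 < h by exact: lt_le_trans h1.
have -> : P * Q - (S * h)^-1 = ((p - 1) * (q - 1) + (p - 1) + (q - 1)) / (S * h).
  by rewrite /p /q -/S; field; rewrite !lt0r_neq0.
rewrite normrM normfV; apply: ler_pM => //.
  have -> : 3 * d = d + d + d by ring.
  apply: le_trans (ler_normD _ _) _; apply: lerD => //.
  apply: le_trans (ler_normD _ _) _; apply: lerD => //.
  by rewrite normrM -[leRHS]mulr1; apply: ler_pM => //; exact: le_trans d1.
rewrite gtr0_norm ?mulr_gt0 // lef_pV2 ?posrE ?mulr_gt0 ?exprn_gt0 //.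
by rewrite expr2; apply: ler_pM => //; exact: ltW.
Qed.

Lemma cont_Re_rsqrt_psum (R : realType) m (z : R[i]) (f : R -> R) : continuous f ->
  continuous (fun t => complex.Re (`|rsqrt_psum m (z * (f t)%:C)| ^+ 2)).
Proof.
move=> cf.
pose S (g : R[i] -> R) t := \sum_(i < m) g (rsqrt_coef R[i] i * z ^+ i) * f t ^+ i.
have SE t : rsqrt_psum m (z * (f t)%:C) = S (@complex.Re R) t +i* S (@complex.Im R) t.
  rewrite /rsqrt_psum.
  apply/eqP; rewrite eq_complex !raddf_sum /=; apply/andP; split; apply/eqP;
  apply: eq_bigr => i _; rewrite exprMn mulrA -rmorphXn /=;
  case: (rsqrt_coef R[i] i * _) => v w /=.
  - by rewrite mulr0 subr0.
  - by rewrite mulr0 add0r.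
have cS g : continuous (S g).
  by apply: cont_sum => i; prove_cont.
suff -> : (fun t => complex.Re (`|rsqrt_psum m (z * (f t)%:C)| ^+ 2)) =
          (fun t => S (@complex.Re R) t ^+ 2 + S (@complex.Im R) t ^+ 2).
  by prove_cont; exact: cS.
apply/funext => t; rewrite SE normc_def -rmorphXn /= sqr_sqrtr //.
by rewrite addr_ge0 // sqr_ge0.
Qed.

Lemma rsqrt_psum_real (R : realType) m (u : R) :
  rsqrt_psum m u%:C = (rsqrt_psum m u)%:C.
Proof.
rewrite /rsqrt_psum rmorph_sum; apply: eq_bigr => i _.
by rewrite rsqrt_coefC [RHS]rmorphM /= rmorphXn.
Qed.

Lemma rsqrt_psum_conj (R : realType) m (z : R[i]) :
  rsqrt_psum m (conjc z) = conjc (rsqrt_psum m z).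
Proof.
rewrite /rsqrt_psum rmorph_sum; apply: eq_bigr => i _.
rewrite rsqrt_coefC [RHS]rmorphM /= rmorphXn. by rewrite oppr0.
Qed.

(** The Euler integral after the substitution sin^2 t. The conjugate pair of
arguments contributes |S(z s^2)|^2, which converges to 1 / |1 - z s^2|; the
modulus is written out in real coordinates. *)
Lemma lauricellaD3_half_integral (R : realType) k (u r : R) (z : R[i]) :
  0 <= u <= r -> `|z| <= r%:C -> r < 1 ->
  lauricellaD (1 / 2 + k%:R) [tuple 1 / 2; 1 / 2; 1 / 2] (1 + k%:R)
    [tuple u%:C; z; conjc z] =
  (2 / (pi * rsqrt_coef R k) *
   qint (fun t => sin t ^+ (2 * k) *
     (Num.sqrt (1 - u * sin t ^+ 2) *
      Num.sqrt ((1 - complex.Re z * sin t ^+ 2) ^+ 2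
                + (complex.Im z * sin t ^+ 2) ^+ 2))^-1))%:C.
Proof.
move=> ur zr r1.
have /andP[u0 ur'] := ur.
have r0 : 0 <= r by exact: le_trans ur'.
have s0 : 0 < 1 - r by rewrite subr_gt0.
have ck := rsqrt_coef_gt0 R k.
have pi0 := pi_gt0 R.
set w : R := 2 / (pi * rsqrt_coef R k).
have w0 : 0 < w by rewrite divr_gt0 // mulr_gt0.
pose f m (t : R) := sin t ^+ (2 * k) *
  (rsqrt_psum m (u * sin t ^+ 2) *
   complex.Re (`|rsqrt_psum m (z * (sin t ^+ 2)%:C)| ^+ 2)).
set h := (X in qint X).
apply: (@lauricellaD_half_lim R 3 k _ _ r).
- by case=> [[|[|[|]]]].
- by rewrite r0.
- case=> [[|[|[|//]]]] ? /=; rewrite (tnth_nth 0) //=.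
    by rewrite normc_def /= expr0n addr0 sqrtr_sqr lecR ger0_norm.
  by rewrite normcJ.
move=> e e0.
have fE m (t : R) : (sin t ^+ (2 * k))%:C *
    \prod_(j < 3) rsqrt_psum m (tnth [tuple u%:C; z; conjc z] j * (sin t ^+ 2)%:C)
    = (f m t)%:C.
  rewrite !big_ord_recl big_ord0 mulr1 !(tnth_nth 0) /= -rmorphM rsqrt_psum_real.
  have -> : conjc z * (sin t ^+ 2)%:C = conjc (z * (sin t ^+ 2)%:C).
    by rewrite [RHS]rmorphM /= oppr0.
  rewrite rsqrt_psum_conj -sqr_normc /f [RHS]rmorphM [X in _ = _ * X]rmorphM /=.
  congr (_ * (_ * _)).
  exact: sqr_normc_real.
have cf m : continuous (f m).
  apply: cont_mul; first by prove_cont.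
  apply: cont_mul; first by apply: cont_sum => i; prove_cont.
  by apply: (@cont_Re_rsqrt_psum _ m z (fun t => sin t ^+ 2)); prove_cont.
have Rez : complex.Re z <= r.
  apply: le_trans (ler_norm _) _; rewrite -lecR.
  exact: le_trans (normc_ge_Re z) zr.
have sin01 (t : R) : 0 <= sin t ^+ 2 <= 1.
  by rewrite sqr_ge0 sin2cos2 gerBl sqr_ge0.
have mul_sin_lt1 (v t : R) : v <= r -> 0 < 1 - v * sin t ^+ 2.
  move=> vr; have /andP[t0 t1] := sin01 t.
  rewrite subr_gt0; apply: le_lt_trans r1; apply: (@le_trans _ _ (r * sin t ^+ 2)).
    exact: ler_wpM2r.
  by rewrite ler_piMr.
have hz0 (t : R) : 0 < (1 - complex.Re z * sin t ^+ 2) ^+ 2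
                + (complex.Im z * sin t ^+ 2) ^+ 2.
  by apply: ltr_wpDr; rewrite ?sqr_ge0 // exprn_gt0 // mul_sin_lt1.
have ch : continuous h.
  rewrite /h; apply: cont_mul; first by prove_cont.
  apply: cont_inv => [t|]; last by prove_cont.
  by rewrite lt0r_neq0 // mulr_gt0 // sqrtr_gt0 // mul_sin_lt1.
(* A uniform bound d on the truncation error moves the result by at most C d. *)
pose C := w * (3 / (1 - r) ^+ 2 * (pi / 2)).
have C0 : 0 < C.
  rewrite /C mulr_gt0 // mulr_gt0 //; last by rewrite divr_gt0.
  by rewrite divr_gt0 // exprn_gt0.
pose d := Num.min 1 (e / C).
have d0 : 0 < d by rewrite lt_min ltr01 divr_gt0.
have : (geometric (3 / (1 - r)) r @ \oo --> (0 : R))%classic.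
  by apply: cvg_geometric; rewrite ger0_norm.
move/cvgrPdist_le => /(_ _ d0) [M _ HM]; exists M => m Mm.
have {HM Mm} md : 3 * r ^+ m / (1 - r) <= d.
  have := HM m Mm; rewrite /= sub0r normrN ger0_norm; first by rewrite mulrAC.
  by rewrite !mulr_ge0 ?exprn_ge0 // invr_ge0 ltW.
have -> : cqint (fun t : R => (sin t ^+ (2 * k))%:C * \prod_j
    rsqrt_psum m (tnth [tuple u%:C; z; conjc z] j * (sin t ^+ 2)%:C)) =
    (qint (f m))%:C.
  by rewrite -cqint_real; congr cqint; apply/funext => t; exact: fE.
rewrite -!rmorphM -rmorphB /= normc_def /= expr0n addr0 sqrtr_sqr lecR.
rewrite -mulrBr normrM gtr0_norm //.
have : `|qint h - qint (f m)| <= 3 * d / (1 - r) ^+ 2 * (pi / 2).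
  apply: qint_dist => // t.
  have /andP[t0 t1] := sin01 t.
  rewrite distrC /f /h -mulrBr normrM -[leRHS]mul1r; apply: ler_pM => //.
    by rewrite exprM normrX exprn_ile1 // ger0_norm.
  have -> : Num.sqrt ((1 - complex.Re z * sin t ^+ 2) ^+ 2
                + (complex.Im z * sin t ^+ 2) ^+ 2) =
            complex.Re `|1 - z * (sin t ^+ 2)%:C|.
    rewrite normc_def; case: (z) => v y /=; congr Num.sqrt; ring.
  apply: rsqrt_psum_approx => //.
  - by rewrite mulr_ge0 //=; apply: le_trans ur'; rewrite ler_piMr.
  - rewrite normrM; apply: le_trans zr; rewrite ler_piMr //.
    by rewrite normc_def /= expr0n addr0 sqrtr_sqr lecR ger0_norm.
  - by rewrite ge_min lexx.
move=> hB; apply: (@le_trans _ _ (C * d)).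
  rewrite /C -mulrA ler_pM2l //; apply: le_trans hB _.
  by rewrite le_eqVlt; apply/orP; left; apply/eqP; ring.
by rewrite mulrC -ler_pdivlMr // ge_min lexx orbT.
Qed.

(** * An improper change of variables *)

Lemma Rintegral_exhaust (R : realType) (G : R -> R) (a b : R) (c : nat -> R) :
  (forall y : R, a <= y < b -> {for y, continuous G}) ->
  (forall y : R, a <= y < b -> 0 <= G y) ->
  {homo c : m n / (m <= n)%N >-> m <= n} ->
  (forall n, c n < b) -> (c @ \oo --> b)%classic ->
  ((\int[lebesgue_measure]_(y in `[a, c n]%classic) (G y)%:E)%E @[n --> \oo] -->
   (\int[lebesgue_measure]_(y in `[a, b]%classic) (G y)%:E)%E)%classic.
Proof.
move=> cG G0 cc cb cvgc.
have mG (i : interval R) : {subset i <= `[a, b[} ->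
    measurable_fun [set` i]%classic G.
  move=> iab; apply: subspace_continuous_measurable_fun => //.
  apply: continuous_in_subspaceT => y; rewrite inE /= => /iab.
  by rewrite in_itv; exact: cG.
have sub n : {subset `[a, c n] <= `[a, b[}.
  by move=> y; rewrite !in_itv /= => /andP[-> yc]; exact: le_lt_trans yc (cb n).
have bigE : (\bigcup_n `[a, c n] = `[a, b[)%classic.
  apply/seteqP; split => [y [n _] /sub //|y /=]; rewrite in_itv /= => /andP[ay yb].
  have [N _ HN] := cvgr_gt b cvgc y yb.
  by exists N => //=; rewrite in_itv /= ay ltW // (HN N) /=.
rewrite -integral_itv_bndo_bndc; last by apply/measurable_EFinP; exact: mG.
rewrite -bigE.
apply: ge0_nondecreasing_set_cvg_integral => //.
- move=> m n mn; apply/subsetPset => y /=; rewrite !in_itv /= => /andP[-> yc].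
  exact: le_trans yc (cc _ _ mn).
- by move=> n; apply/measurable_EFinP; apply: mG; exact: sub.
- by move=> n y /sub; rewrite in_itv lee_fin; exact: G0.
Qed.

(** Here G may be unbounded at F b, while G (F x) F'(x) extends continuously
to b. The usual rule applies on [a, c] for c < b; both sides converge as c
tends to b, by monotone convergence. *)
Lemma Rintegral_subst_improper (R : realType) (F f G h : R -> R) (a b : R) :
  a < b -> (forall x : R, is_derive x 1 F (f x)) -> continuous f ->
  (forall x : R, a <= x < b -> 0 < f x) ->
  (forall y : R, F a <= y < F b -> {for y, continuous G}) ->
  (forall y : R, F a <= y < F b -> 0 <= G y) ->
  continuous h -> (forall x : R, a <= x < b -> G (F x) * f x = h x) ->
  \int[lebesgue_measure]_(y in `[F a, F b]%classic) G y =
  \int[lebesgue_measure]_(x in `[a, b]%classic) h x.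
Proof.
move=> ab dF cf f0 cG G0 ch hE.
have cF : continuous F.
  by move=> x; apply/differentiable_continuous/derivable1_diffP; case: (dF x).
have dFE : derive1 F = f by apply/funext => x; rewrite derive1E; case: (dF x).
have Fincr x y : a <= x -> x < y -> y <= b -> F x < F y.
  move=> ax xy yb; apply: (@gtr0_derive1_lt_cc _ F a b) => //.
  - by move=> z; rewrite in_itv dFE /= => /andP[az zb]; apply: f0; rewrite zb ltW.
  - exact: continuous_subspaceT.
  - by rewrite in_itv /= ax ltW // (lt_le_trans xy).
  - by rewrite in_itv /= yb ltW // (le_lt_trans ax).
have Fle x y : a <= x -> x <= y -> y <= b -> F x <= F y.
  by move=> ax; rewrite le_eqVlt => /predU1P[-> //|xy] yb; exact/ltW/Fincr.
have h0 x : a <= x < b -> 0 <= h x.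
  move=> axb; have /andP[ax xb] := axb.
  rewrite -hE // mulr_ge0 //; last exact/ltW/f0.
  by apply/G0/andP; split; [apply: Fle => //; exact: ltW|exact: Fincr].
pose c n := b - (b - a) * @harmonic R n.
have hn n : 0 < @harmonic R n <= 1.
  by rewrite /= invr_gt0 ltr0n invf_le1 // ler1n.
have ba : 0 < b - a by rewrite subr_gt0.
have cb n : c n < b.
  by rewrite /c gtrBl mulr_gt0 //; case/andP: (hn n).
have ac n : a <= c n.
  by rewrite /c lerBrDr -lerBrDl ler_piMr ?(ltW ba) //; case/andP: (hn n).
have cmono : {homo c : m n / (m <= n)%N >-> m <= n}.
  move=> m n mn; rewrite /c lerB // ler_wpM2l ?(ltW ba) //=.
  by rewrite lef_pV2 ?posrE ?ltr0n // ler_nat.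
have cvgc : (c @ \oo --> b)%classic.
  rewrite -[X in (_ --> X)%classic]subr0 -(mulr0 (b - a)).
  by apply: cvgB; [exact: cvg_cst|apply: cvgMl_tmp; exact: cvg_harmonic].
have cvgFc : ((F \o c) @ \oo --> F b)%classic.
  exact: cvg_comp cvgc (cF b).
have L1 := @Rintegral_exhaust R G (F a) (F b) (F \o c) cG G0.
have L2 := @Rintegral_exhaust R h a b c.
rewrite /Rintegral; congr fine; apply: (cvg_unique _ (L1 _ _ _)) => //.
- move=> m n mn; apply: Fle => //; [exact: cmono|exact: ltW].
- by move=> n; apply: Fincr.
have -> : (fun n => \int[lebesgue_measure]_(y in `[F a, (F \o c) n]%classic) (G y)%:E)%E =
          (fun n => \int[lebesgue_measure]_(x in `[a, c n]%classic) (h x)%:E)%E.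
  apply/funext => n; rewrite integration_by_substitution_increasing //.
  - apply: eq_integral => x; rewrite inE /= in_itv /= => /andP[ax xc].
    by rewrite dFE -hE // ax (le_lt_trans xc).
  - move=> x y; rewrite !in_itv /= => /andP[ax _] /andP[_ yc] xy.
    by apply: Fincr => //; rewrite (le_trans yc) // ltW.
  - by move=> x _; rewrite dFE; exact: cf.
  - by apply/cvg_ex; exists (f a); rewrite dFE; apply: cvg_at_right_filter; exact: cf.
  - by apply/cvg_ex; exists (f (c n)); rewrite dFE; apply: cvg_at_left_filter; exact: cf.
  - split => [x _| |]; first by case: (dF x).
    + by apply: cvg_at_right_filter; exact: cF.
    + by apply: cvg_at_left_filter; exact: cF.
  - apply: continuous_in_subspaceT => y; rewrite inE /= in_itv /= => /andP[ay yc].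
    by apply: cG; rewrite ay (le_lt_trans yc) // Fincr.
by apply: L2 => // y _; exact: ch.
Qed.

(** * Complete elliptic integrals in a new variable *)

(** With F t = sin phi the hypotheses say cos phi = cos t * p t,
sqrt (1 - k^2 sin^2 phi) = q t and d phi / d t = w t, so that the integrals of
d phi / sqrt (1 - k^2 sin^2 phi) and sqrt (1 - k^2 sin^2 phi) d phi become those
of w / q and w q. *)
Lemma elliptic_subst (R : realType) (k : R) (F f p q w : R -> R) :
  (forall t : R, is_derive t 1 F (f t)) ->
  continuous p -> continuous q -> continuous w ->
  (forall t, 0 < p t) -> (forall t, 0 < q t) -> (forall t, 0 < w t) ->
  F 0 = 0 -> F (pi / 2) = 1 ->
  (forall t, 1 - F t ^+ 2 = (cos t * p t) ^+ 2) ->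
  (forall t, 1 - k ^+ 2 * F t ^+ 2 = q t ^+ 2) ->
  (forall t, f t = cos t * p t * w t) ->
  ellipticK k = qint (fun t => w t / q t) /\
  ellipticE k = qint (fun t => w t * q t).
Proof.
move=> dF cp cq cw p0 q0 w0 F0 F1 Fp Fq fE.
have k1 : k ^+ 2 < 1.
  have := Fq (pi / 2); rewrite F1 expr1n mulr1 => hk.
  by rewrite -subr_gt0 hk exprn_gt0.
have P1 (y : R) : 0 <= y < 1 -> 0 < 1 - y ^+ 2.
  by move=> /andP[y0 y1]; rewrite subr_gt0 expr_lt1.
have P2 (y : R) : 0 <= y < 1 -> 0 < 1 - k ^+ 2 * y ^+ 2.
  move=> yb; have := P1 y yb; rewrite !subr_gt0 => y1.
  by apply: le_lt_trans y1; rewrite ler_piMl ?sqr_ge0 // ltW.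
have cP1 : continuous (fun y : R => 1 - y ^+ 2).
  by apply: cont_add; [exact: cont_cst|apply/cont_opp/exprn_continuous].
have cP2 : continuous (fun y : R => 1 - k ^+ 2 * y ^+ 2).
  apply: cont_add; first exact: cont_cst.
  by apply/cont_opp/cont_mul; [exact: cont_cst|exact: exprn_continuous].
have cf : continuous f.
  by rewrite (_ : f = fun t => cos t * p t * w t); [prove_cont|exact/funext].
have cos0 (t : R) : 0 <= t < pi / 2 -> 0 < cos t.
  move=> /andP[t0 t1]; apply: cos_gt0_pihalf; rewrite t1 andbT.
  apply: lt_le_trans t0; by rewrite oppr_lt0 divr_gt0 ?(pi_gt0 R).
have f0 t : 0 <= t < pi / 2 -> 0 < f t.
  by move=> /cos0 ct; rewrite fE !mulr_gt0.
have pih0 : 0 < pi / 2 :> R by rewrite divr_gt0 ?(pi_gt0 R).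
have q_neq0 t : q t != 0 by rewrite gt_eqF.
have reg (t : R) : 0 <= t < pi / 2 ->
    [/\ cos t != 0, 0 <= cos t & [/\ p t != 0, 0 <= p t, q t != 0 & 0 <= q t]].
  by move=> /cos0 ct; split; rewrite ?gt_eqF ?(ltW ct) //; split; rewrite ?gt_eqF // ltW.
split.
- rewrite /ellipticK -{1}F0 -F1.
  apply: (@Rintegral_subst_improper _ F f _ _ 0 (pi / 2)) => //.
  + rewrite F0 F1 => y yb; apply: cvgV.
      by rewrite gt_eqF // sqrtr_gt0 mulr_gt0 // ?P1 ?P2.
    have cS := cont_sqrt (cont_mul cP1 cP2).
    exact: cS.
  + by prove_cont.
  + move=> t /reg[ct ct0 [pt pt0 qt qt0]].
    rewrite F1 Fp Fq -exprMn sqrtr_sqr ger0_norm ?mulr_ge0 // fE.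
    by field; rewrite ct pt qt.
- rewrite /ellipticE -{1}F0 -F1.
  apply: (@Rintegral_subst_improper _ F f _ _ 0 (pi / 2)) => //.
  + rewrite F0 F1 => y yb.
    apply: (@continuous_comp _ _ _
      (fun y : R => (1 - k ^+ 2 * y ^+ 2) / (1 - y ^+ 2)) Num.sqrt);
      last exact: sqrt_continuous.
    by apply: cvgM; [exact: cP2|apply: cvgV; [rewrite gt_eqF // P1|exact: cP1]].
  + by prove_cont.
  + move=> t /reg[ct ct0 [pt pt0 qt qt0]].
    rewrite F1 Fp Fq -exprVn -exprMn sqrtr_sqr ger0_norm ?mulr_ge0 ?invr_ge0 ?mulr_ge0 // fE.
    by field; rewrite ct pt.
Qed.

(** * The two radicals *)

Section LandenSubstitutions.
Context {R : realType} (B a : R).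
Hypothesis B1 : 1 < B.

Definition landen_A (t : R) : R := Num.sqrt (B ^+ 2 - sin t ^+ 2).

Definition landen_W (s : R) : R := B ^+ 2 - 2 * B * cos (2 * a) * s ^+ 2 + s ^+ 4.

Definition landen_V (t : R) : R := Num.sqrt (landen_W (sin t)).

Definition landen_D : R := Num.sqrt (landen_W 1).

Lemma sin2_le1 (t : R) : sin t ^+ 2 <= 1.
Proof. by rewrite sin2cos2 gerBl sqr_ge0. Qed.

Lemma cos_dbl_cos : cos (2 * a) = 2 * cos a ^+ 2 - 1.
Proof. by rewrite mulr_natl cos_mulr2n mulr_natl. Qed.

Lemma cos_dbl_sin : cos (2 * a) = 1 - 2 * sin a ^+ 2.
Proof. by rewrite cos_dbl_cos cos2sin2; ring. Qed.

Lemma B_gt0 : 0 < B.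
Proof. exact: lt_trans ltr01 B1. Qed.

Lemma landen_A_arg (t : R) : 0 < B ^+ 2 - sin t ^+ 2.
Proof. by have := sin2_le1 t; have := B1; nra. Qed.

Lemma landen_W_gt0 (s : R) : s ^+ 2 <= 1 -> 0 < landen_W s.
Proof.
move=> s1; have -> : landen_W s = (B - s ^+ 2) ^+ 2 + 4 * B * (sin a * s) ^+ 2.
  by rewrite /landen_W cos_dbl_sin; ring.
apply: ltr_pwDl; first by rewrite exprn_gt0 // subr_gt0 (le_lt_trans s1).
by apply: mulr_ge0; [rewrite mulr_ge0 // ltW // B_gt0|exact: sqr_ge0].
Qed.

Lemma landen_A_gt0 t : 0 < landen_A t.
Proof. by rewrite sqrtr_gt0 landen_A_arg. Qed.

Lemma landen_V_gt0 t : 0 < landen_V t.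
Proof. by rewrite sqrtr_gt0 landen_W_gt0 // sin2_le1. Qed.

Lemma landen_D_gt0 : 0 < landen_D.
Proof. by rewrite sqrtr_gt0 landen_W_gt0 // expr1n. Qed.

Lemma landen_A_sqr t : landen_A t ^+ 2 = B ^+ 2 - sin t ^+ 2.
Proof. by rewrite sqr_sqrtr // ltW // landen_A_arg. Qed.

Lemma landen_V_sqr t : landen_V t ^+ 2 = landen_W (sin t).
Proof. by rewrite sqr_sqrtr // ltW // landen_W_gt0 // sin2_le1. Qed.

Lemma landen_D_sqr : landen_D ^+ 2 = landen_W 1.
Proof. by rewrite sqr_sqrtr // ltW // landen_W_gt0 // expr1n. Qed.

Lemma cont_landen_A : continuous landen_A.
Proof. rewrite /landen_A; prove_cont.  Qed.

Lemma cont_landen_V : continuous landen_V.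
Proof. by rewrite /landen_V /landen_W; prove_cont. Qed.

Lemma Bsin_gt0 (t : R) : 0 < B + sin t ^+ 2.
Proof. by rewrite ltr_pwDl ?sqr_ge0 ?B_gt0. Qed.

Lemma Bsin_sub_gt0 (t : R) : 0 < B - sin t ^+ 2.
Proof. by rewrite subr_gt0 (le_lt_trans (sin2_le1 t)). Qed.

Lemma deriv_landen_A (t : R) :
  is_derive t 1 landen_A (- (sin t * cos t) / landen_A t).
Proof.
have A0 := landen_A_gt0 t.
apply: deriv_at_eq.
  by rewrite /landen_A; prove_deriv; exact: landen_A_arg.
rewrite -/(landen_A t).
by cbv beta; field; rewrite gt_eqF.
Qed.

Lemma deriv_landen_V (t : R) : is_derive t 1 landen_V
  (2 * sin t * cos t * (sin t ^+ 2 - B * cos (2 * a)) / landen_V t).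
Proof.
have V0 := landen_V_gt0 t.
apply: deriv_at_eq.
  by rewrite /landen_V /landen_W; prove_deriv; exact: landen_W_gt0 (sin2_le1 t).
rewrite -/(landen_W (sin t)) -/(landen_V t).
by cbv beta; field; rewrite gt_eqF.
Qed.

End LandenSubstitutions.

(** * The two quadratic substitutions *)

Section LandenIntegrals.
Context {R : realType} (B a : R).
Hypothesis B1 : 1 < B.
Local Notation A := (landen_A B).
Local Notation V := (landen_V B a).
Local Notation D := (landen_D B a).

Let B0 : 0 < B := B_gt0 B1.
Let A0 t : 0 < A t := landen_A_gt0 B1 t.
Let V0 t : 0 < V t := landen_V_gt0 a B1 t.
Let D0 : 0 < D := landen_D_gt0 a B1.

(** The substitution sin phi = (B+1) s / (B+s^2), of Gauss: it takes 0 and 1 to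
themselves, cos phi = cos t A / (B+s^2), and 1 - k^2 sin^2 phi = V^2 / (B+s^2)^2
because (B+s^2)^2 - V^2 = 4 B cos(a)^2 s^2. *)
Lemma elliptic_plus_modulus (k : R) :
  k ^+ 2 * (1 + B) ^+ 2 = 4 * B * cos a ^+ 2 ->
  ellipticK k = qint (fun t => (B + 1) * (B - sin t ^+ 2) / (A t * V t)) /\
  ellipticE k = qint (fun t =>
    (B + 1) * (B - sin t ^+ 2) * V t / (A t * (B + sin t ^+ 2) ^+ 2)).
Proof.
move=> kE.
have P0 (t : R) : B + sin t ^+ 2 != 0 by rewrite gt_eqF // Bsin_gt0.
have k2E : k ^+ 2 = 4 * B * cos a ^+ 2 / (1 + B) ^+ 2.
  by rewrite -kE mulfK // expf_neq0 // gt_eqF // addr_gt0.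
pose F (t : R) := (B + 1) * sin t / (B + sin t ^+ 2).
pose p t := A t / (B + sin t ^+ 2).
pose q t := V t / (B + sin t ^+ 2).
pose w (t : R) := (B + 1) * (B - sin t ^+ 2) / ((B + sin t ^+ 2) * A t).
have An t : A t != 0 by rewrite gt_eqF.
have Vn t : V t != 0 by rewrite gt_eqF.
have cA := @cont_landen_A R B; have cV := @cont_landen_V R B a.
have [] := @elliptic_subst R k F (fun t => cos t * p t * w t) p q w.
- move=> t; apply: deriv_at_eq; first by rewrite /F; prove_deriv.
  by cbv beta; rewrite /p /w; field; rewrite P0 An.
- by rewrite /p; prove_cont.
- by rewrite /q; prove_cont.
- by rewrite /w; prove_cont => t; rewrite mulf_neq0.
- by move=> t; rewrite divr_gt0 // Bsin_gt0.
- by move=> t; rewrite divr_gt0 // Bsin_gt0.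
- move=> t; rewrite divr_gt0 // mulr_gt0 // ?Bsin_gt0 ?Bsin_sub_gt0 //.
  by rewrite addr_gt0.
- by rewrite /F sin0 mulr0 mul0r.
- by rewrite /F sin_pihalf expr1n mulr1 divff // gt_eqF // addr_gt0.
- move=> t; rewrite /F /p.
  rewrite -[RHS](_ : cos t ^+ 2 * A t ^+ 2 / (B + sin t ^+ 2) ^+ 2 = _).
    by rewrite landen_A_sqr // cos2sin2; field; rewrite P0.
  by field; rewrite P0.
- move=> t; rewrite k2E /F /q [RHS]exprMn [in RHS]exprVn landen_V_sqr //.
  rewrite /landen_W cos_dbl_cos; field.
  by rewrite P0 gt_eqF // addr_gt0.
- by [].
move=> -> ->; split; congr qint; apply/funext => t; rewrite /w /q.
- by field; rewrite P0 An Vn.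
- by field; rewrite P0 An.
Qed.

(** The substitution sin phi = D s / V: here cos phi = cos t A / V, and
1 - k^2 sin^2 phi = (B-s^2)^2 / V^2 because V^2 - (B-s^2)^2 = 4 B sin(a)^2 s^2. *)
Lemma elliptic_minus_modulus (k : R) :
  k ^+ 2 * D ^+ 2 = 4 * B * sin a ^+ 2 ->
  ellipticK k = qint (fun t => D * (B + sin t ^+ 2) / (A t * V t)) /\
  ellipticE k = qint (fun t =>
    D * (B + sin t ^+ 2) * (B - sin t ^+ 2) ^+ 2 / (A t * V t ^+ 3)).
Proof.
move=> kE.
have Dn : D != 0 by rewrite gt_eqF.
have k2E : k ^+ 2 = 4 * B * sin a ^+ 2 / D ^+ 2.
  by rewrite -kE mulfK // expf_neq0.
pose F (t : R) := D * sin t / V t.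
pose p t := A t / V t.
pose q t := (B - sin t ^+ 2) / V t.
pose w (t : R) := D * (B ^+ 2 - sin t ^+ 4) / (V t ^+ 2 * A t).
have An t : A t != 0 by rewrite gt_eqF.
have Vn t : V t != 0 by rewrite gt_eqF.
have cA := @cont_landen_A R B; have cV := @cont_landen_V R B a.
have sB (t : R) : B ^+ 2 - sin t ^+ 4 = (B - sin t ^+ 2) * (B + sin t ^+ 2) by ring.
have Bn (t : R) : B - sin t ^+ 2 != 0 by rewrite gt_eqF // Bsin_sub_gt0.
have V1 : V (pi / 2) = D by rewrite /landen_V sin_pihalf.
have Wt t : B ^+ 2 - 2 * B * cos (2 * a) * sin t ^+ 2 + sin t ^+ 4 = V t ^+ 2.
  by rewrite landen_V_sqr.
have [] := @elliptic_subst R k F (fun t => cos t * p t * w t) p q w.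
- move=> t; apply: deriv_at_eq.
    rewrite /F; apply: deriv_mul; first by prove_deriv.
    by apply: deriv_inv => //; exact: deriv_landen_V.
  cbv beta; rewrite /p /w.
  have W2 := Wt t.
  rewrite -[LHS](_ : D * cos t * (V t ^+ 2
      - 2 * sin t ^+ 2 * (sin t ^+ 2 - B * cos (2 * a))) / V t ^+ 3 = _);
    last by field; rewrite Vn.
  rewrite -{1}W2; field.
  by rewrite Vn An.
- by rewrite /p; prove_cont.
- by rewrite /q; prove_cont.
- by rewrite /w; prove_cont => t; rewrite mulf_neq0 // expf_neq0.
- by move=> t; rewrite divr_gt0.
- by move=> t; rewrite divr_gt0 // Bsin_sub_gt0.
- move=> t; rewrite /w sB divr_gt0 // mulr_gt0 // ?exprn_gt0 //.
  by rewrite mulr_gt0 // ?Bsin_gt0 ?Bsin_sub_gt0.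
- by rewrite /F sin0 mulr0 mul0r.
- by rewrite /F sin_pihalf V1 mulr1 divff.
- move=> t; rewrite /F /p.
  have D2 := landen_D_sqr a B1; rewrite /landen_W !expr1n !mulr1 in D2.
  have A2 := landen_A_sqr B1 t; have C2 := cos2sin2 t.
  rewrite -[LHS](_ : (V t ^+ 2 - D ^+ 2 * sin t ^+ 2) / V t ^+ 2 = _);
    last by field; rewrite Vn.
  rewrite -[RHS](_ : cos t ^+ 2 * A t ^+ 2 / V t ^+ 2 = _);
    last by field; rewrite Vn.
  by rewrite D2 A2 C2 -{1}Wt; congr (_ / _); ring.
- move=> t; rewrite k2E /F /q.
  rewrite -[LHS](_ : (V t ^+ 2 - 4 * B * sin a ^+ 2 * sin t ^+ 2) / V t ^+ 2 = _);
    last by field; rewrite Vn Dn.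
  by rewrite -{1}Wt cos_dbl_sin exprMn exprVn; congr (_ / _); ring.
- by [].
move=> -> ->; split; congr qint; apply/funext => t; rewrite /w /q sB.
- by field; rewrite Vn An Bn.
- by field; rewrite Vn An.
Qed.

End LandenIntegrals.

(** * The combination of elliptic integrals *)

Section Combination.
Context {R : realType} (B a : R).
Hypothesis B1 : 1 < B.
Local Notation A := (landen_A B).
Local Notation V := (landen_V B a).
Local Notation D := (landen_D B a).
Local Notation c := (cos (2 * a)).

Let B0 : 0 < B := B_gt0 B1.
Let A0 t : 0 < A t := landen_A_gt0 B1 t.
Let V0 t : 0 < V t := landen_V_gt0 a B1 t.
Let D0 : 0 < D := landen_D_gt0 a B1.

Definition landen_combination (t : R) : R :=
  (1 + B) * ((B + 1) * (B - sin t ^+ 2) * V t / (A t * (B + sin t ^+ 2) ^+ 2))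
  - (B ^+ 2 + B + 1) / (1 + B) * ((B + 1) * (B - sin t ^+ 2) / (A t * V t))
  + (B ^+ 2 - B + 1) / D * (D * (B + sin t ^+ 2) / (A t * V t))
  - D * (D * (B + sin t ^+ 2) * (B - sin t ^+ 2) ^+ 2 / (A t * V t ^+ 3)).

(** The reduction of the two integrals with a double pole at infinity, in the
variables 1/v + v and 1/v - v with v = s/b, leaves two boundary terms that grow
like 1/v; this is their difference, in which the growth cancels. *)
Definition landen_boundary (t : R) : R :=
  2 * cos t * A t * (sin t * (sin t ^+ 2 - c * B)) / (V t * (B + sin t ^+ 2)).

Lemma deriv_landen_boundary (t : R) : is_derive t 1 landen_boundary
  (2 * sin t ^+ 4 / (A t * V t) - landen_combination t).
Proof.
have P0 : B + sin t ^+ 2 != 0 by rewrite gt_eqF // Bsin_gt0.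
have An : A t != 0 by rewrite gt_eqF.
have Vn : V t != 0 by rewrite gt_eqF.
have Dn : D != 0 by rewrite gt_eqF.
have Bn : 1 + B != 0 by rewrite gt_eqF // addr_gt0.
apply: deriv_at_eq.
  rewrite /landen_boundary; apply: deriv_mul.
    apply: deriv_mul; last by prove_deriv.
    by apply: deriv_mul; [prove_deriv|exact: deriv_landen_A].
  apply: deriv_inv; first by rewrite mulf_neq0.
  by apply: deriv_mul; [exact: deriv_landen_V|prove_deriv].
cbv beta; rewrite /landen_combination.
have D2 := landen_D_sqr a B1; rewrite /landen_W !expr1n !mulr1 in D2.
have A2 := landen_A_sqr B1 t; have C2 := cos2sin2 t.
have V2 := landen_V_sqr a B1 t; rewrite /landen_W in V2.
(* Once denominators are cleared, cos t, A, V and D occur to even powers only. *)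
move: (sin t) (cos t) (A t) (V t) D c P0 An Vn Dn A2 V2 C2 D2.
move=> s co x v d cc P0 An Vn Dn A2 V2 C2 D2.
field : A2 V2 C2 D2.
by rewrite Vn An Dn Bn P0.
Qed.

Let cint : continuous (fun t => 2 * sin t ^+ 4 / (A t * V t)).
Proof.
have cA := @cont_landen_A R B; have cV := @cont_landen_V R B a.
by prove_cont => t; rewrite mulf_neq0 // gt_eqF.
Qed.

Lemma elliptic_combination (k1 k2 : R) :
  k1 ^+ 2 * (1 + B) ^+ 2 = 4 * B * cos a ^+ 2 ->
  k2 ^+ 2 * D ^+ 2 = 4 * B * sin a ^+ 2 ->
  (1 + B) * ellipticE k1 - (B ^+ 2 + B + 1) / (1 + B) * ellipticK k1
  + (B ^+ 2 - B + 1) / D * ellipticK k2 - D * ellipticE k2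
  = qint (fun t => 2 * sin t ^+ 4 / (A t * V t)).
Proof.
move=> k1E k2E.
have cA := @cont_landen_A R B; have cV := @cont_landen_V R B a.
have P0 (t : R) : B + sin t ^+ 2 != 0 by rewrite gt_eqF // Bsin_gt0.
have An t : A t != 0 by rewrite gt_eqF.
have Vn t : V t != 0 by rewrite gt_eqF.
have [-> ->] := elliptic_plus_modulus B1 k1E.
have [-> ->] := elliptic_minus_modulus B1 k2E.
have c1 : continuous (fun t : R =>
    (B + 1) * (B - sin t ^+ 2) * V t / (A t * (B + sin t ^+ 2) ^+ 2)).
  by prove_cont => t; rewrite mulf_neq0 // expf_neq0.
have c2 : continuous (fun t : R => (B + 1) * (B - sin t ^+ 2) / (A t * V t)).
  by prove_cont => t; rewrite mulf_neq0.
have c3 : continuous (fun t : R => D * (B + sin t ^+ 2) / (A t * V t)).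
  by prove_cont => t; rewrite mulf_neq0.
have c4 : continuous (fun t : R =>
    D * (B + sin t ^+ 2) * (B - sin t ^+ 2) ^+ 2 / (A t * V t ^+ 3)).
  by prove_cont => t; rewrite mulf_neq0 // expf_neq0.
have linear (x1 x2 x3 x4 : R) (f1 f2 f3 f4 : R -> R) :
    continuous f1 -> continuous f2 -> continuous f3 -> continuous f4 ->
    let f t := x1 * f1 t - x2 * f2 t + x3 * f3 t - x4 * f4 t in
    continuous f /\
    x1 * qint f1 - x2 * qint f2 + x3 * qint f3 - x4 * qint f4 = qint f.
  move=> e1 e2 e3 e4 f; split; first by rewrite /f; prove_cont.
  by rewrite /f -!qintZ // -qintB -?qintD -?qintB //; prove_cont.
have [cc ->] := linear (1 + B) ((B ^+ 2 + B + 1) / (1 + B))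
  ((B ^+ 2 - B + 1) / D) D _ _ _ _ c1 c2 c3 c4.
rewrite -/landen_combination in cc *.
have := qint_derive deriv_landen_boundary (cont_add cint (cont_opp cc)).
rewrite qintB // /landen_boundary cos_pihalf sin0 !(mulr0, mul0r) subr0.
by move/subr0_eq.
Qed.

(** The integrand is at least a positive multiple of sin^4, since A <= B and
V <= B + 1. *)
Lemma qint_combination_gt0 : 0 < qint (fun t => 2 * sin t ^+ 4 / (A t * V t)).
Proof.
have AB t : A t <= B.
  rewrite -[leRHS]gtr0_norm // -sqrtr_sqr ler_wsqrtr //.
  by rewrite gerBl sqr_ge0.
have VB t : V t <= B + 1.
  have B10 : 0 < B + 1 by rewrite addr_gt0.
  rewrite -[leRHS]gtr0_norm // -sqrtr_sqr ler_wsqrtr // /landen_W.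
  have := sin2_le1 t; have := sqr_ge0 (sin t); have := cos_geN1 (2 * a).
  have -> : sin t ^+ 4 = (sin t ^+ 2) ^+ 2 by rewrite -exprM.
  move: (sin t ^+ 2) c => u v v1 u0 u1.
  have h1 : 0 <= B * (u * (v + 1)).
    by rewrite mulr_ge0 ?(ltW B0) // mulr_ge0 // -lerBlDr sub0r.
  have h2 : 0 <= B * (1 - u) by rewrite mulr_ge0 ?(ltW B0) // subr_ge0.
  have h3 : 0 <= (1 - u) * (1 + u) by rewrite mulr_ge0 // ?subr_ge0 // addr_ge0.
  by nra.
pose m : R := 2 / (B * (B + 1)).
have m0 : 0 < m by rewrite divr_gt0 // mulr_gt0 // addr_gt0.
have c4 : continuous (fun t : R => m * sin t ^+ (2 * 2)) by prove_cont.
apply: (@lt_le_trans _ _ (qint (fun t : R => m * sin t ^+ (2 * 2)))).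
  rewrite qintZ; last by prove_cont.
  by rewrite wallis mulr_gt0 // mulr_gt0 ?rsqrt_coef_gt0 // divr_gt0 // pi_gt0.
rewrite /qint; apply: le_Rintegral => //; try exact: qint_integrable.
move=> t _ /=; rewrite /m mulrAC ler_wpM2l //.
  by rewrite mulr_ge0 // exprM sqr_ge0.
rewrite lef_pV2 ?posrE ?mulr_gt0 ?addr_gt0 //.
by rewrite ler_pM // ltW.
Qed.

End Combination.

(** * The formula for pi *)

Unset Implicit Arguments.

Theorem theorem5p7 (R : realType) (a b : R) (hb : 1 < b) :
  let D : R := Num.sqrt (1 - 2 * b ^+ 2 * cos (2 * a) + b ^+ 4) in
  let k1 : R := 2 * b * cos a / (1 + b ^+ 2) in
  let k2 : R := 2 * b * sin a / D in
  (pi : R)%:C =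
  8 * b%:C ^+ 4 /
    (3 * lauricellaD (5 / 2) [tuple 1 / 2; 1 / 2; 1 / 2] 3
           [tuple 1 / b%:C ^+ 4;
                  expC (- (2 * 'i%C * a%:C)) / b%:C ^+ 2;
                  expC (2 * 'i%C * a%:C) / b%:C ^+ 2])
  * ((1 + b ^+ 2) * ellipticE k1
     - (b ^+ 4 + b ^+ 2 + 1) / (1 + b ^+ 2) * ellipticK k1
     + (b ^+ 4 - b ^+ 2 + 1) / D * ellipticK k2
     - D * ellipticE k2)%:C.
Proof.
move=> D k1 k2.
pose B := b ^+ 2.
have b0 : 0 < b by exact: lt_trans hb.
have B1 : 1 < B by rewrite /B expr_gt1 // ltW.
have B0 : 0 < B by exact: lt_trans B1.
have DE : D = landen_D B a.
  by rewrite /D /landen_D /landen_W; congr Num.sqrt; rewrite /B; ring.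
have D0 : 0 < D by rewrite DE landen_D_gt0.
have b4 : b ^+ 4 = B ^+ 2 by rewrite /B -exprM.
have Dn : D != 0 by rewrite gt_eqF.
have Bn : B != 0 by rewrite gt_eqF.
have B1n : 1 + B != 0 by rewrite gt_eqF // addr_gt0.
have k1E : k1 ^+ 2 * (1 + B) ^+ 2 = 4 * B * cos a ^+ 2.
  by rewrite /k1 /B; field.
have k2E : k2 ^+ 2 * landen_D B a ^+ 2 = 4 * B * sin a ^+ 2.
  by rewrite -DE /k2 /B; field.
rewrite b4 -/B DE (elliptic_combination B1 k1E k2E).
set X := qint _.
have X0 : 0 < X by exact: qint_combination_gt0.
pose z : R[i] := (cos (2 * a) / B) +i* (- (sin (2 * a) / B)).
have argE : 2 * 'i%C * a%:C = 0 +i* (2 * a).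
  rewrite (_ : 2 = (2 : R)%:C); last by rewrite rmorph_nat.
  by apply/eqP; rewrite eq_complex /=; apply/andP; split; apply/eqP; ring.
have divB (x y : R) : (x +i* y) / b%:C ^+ 2 = (x / B) +i* (y / B).
  rewrite -rmorphXn -fmorphV /=.
  by apply/eqP; rewrite eq_complex /=; apply/andP; split; apply/eqP; rewrite /B; ring.
have expCi (y : R) : expC (0 +i* y) = cos y +i* sin y.
  by rewrite /expC /= expR0 mul1r.
have zE : expC (- (2 * 'i%C * a%:C)) / b%:C ^+ 2 = z.
  rewrite argE (_ : - (0 +i* (2 * a)) = 0 +i* (- (2 * a))); last first.
    by apply/eqP; rewrite eq_complex /= oppr0 !eqxx.
  by rewrite expCi divB cosN sinN mulNr.
have zcE : expC (2 * 'i%C * a%:C) / b%:C ^+ 2 = conjc z.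
  by rewrite argE expCi divB /z /= opprK.
have uE : 1 / b%:C ^+ 4 = (B ^- 2)%:C.
  by rewrite -b4 fmorphV rmorphXn div1r.
have zn : `|z| <= (B^-1)%:C.
  rewrite normc_def /= lecR -[leRHS]gtr0_norm ?invr_gt0 // -sqrtr_sqr.
  apply: ler_wsqrtr.
  by rewrite sqrrN !exprMn -mulrDl cos2Dsin2 mul1r.
rewrite zE zcE uE.
(* The parameters 5/2 and 3 are 1/2 + k and 1 + k with k = 2. *)
have -> : 5 / 2 = 1 / 2 + 2%:R :> R[i] by field.
have -> : 3 = 1 + 2%:R :> R[i] by ring.
rewrite (@lauricellaD3_half_integral R 2 (B ^- 2) B^-1 z) //; last 2 first.
- rewrite invr_ge0 exprn_ge0 ?(ltW B0) //= expr2 invfM.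
  by rewrite ler_piMr ?invr_ge0 ?(ltW B0) // invf_le1 // ltW.
- by rewrite invf_lt1.
have -> : qint (fun t : R => sin t ^+ (2 * 2) *
    (Num.sqrt (1 - B ^- 2 * sin t ^+ 2) *
     Num.sqrt ((1 - complex.Re z * sin t ^+ 2) ^+ 2 +
               (complex.Im z * sin t ^+ 2) ^+ 2))^-1) = B ^+ 2 / 2 * X.
  have cA := @cont_landen_A R B; have cV := @cont_landen_V R B a.
  have A0 t := landen_A_gt0 B1 t; have V0 t := landen_V_gt0 a B1 t.
  have An t : landen_A B t != 0 by rewrite gt_eqF.
  have Vn t : landen_V B a t != 0 by rewrite gt_eqF.
  rewrite /X -qintZ; last by prove_cont => t; rewrite mulf_neq0.
  congr qint; apply/funext => t.
  have -> : 1 - B ^- 2 * sin t ^+ 2 = (landen_A B t / B) ^+ 2.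
    by rewrite [RHS]exprMn landen_A_sqr //; field.
  have -> : (1 - complex.Re z * sin t ^+ 2) ^+ 2 +
      (complex.Im z * sin t ^+ 2) ^+ 2 = (landen_V B a t / B) ^+ 2.
    rewrite [RHS]exprMn landen_V_sqr // /landen_W /=.
    have S2 := sin2cos2 (2 * a).
    by field : S2.
  rewrite !sqrtr_sqr !ger0_norm ?divr_ge0 ?(ltW B0) ?ltW //.
  by rewrite -[(2 * 2)%N]/4%N; field; rewrite An Vn.
(* The constant 2 / (pi c_2) is 16 / (3 pi). *)
have c2 : rsqrt_coef R 2 = 3 / 8.
  by rewrite /rsqrt_coef !pochhammerS /pochhammer big_ord0 /factorial /=; field.
rewrite c2 -rmorphXn b4.
have cast (u w x : R) :
    8 * u%:C / ((1 + 2) * w%:C) * x%:C = (8 * u / (3 * w) * x)%:C.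
  by rewrite !rmorphM fmorphV rmorphM !rmorph_nat /= (_ : 1 + 2 = 3) //; ring.
rewrite cast; congr (real_complex R _).
have := pi_gt0 R; move: (pi) => p p0; field.
by rewrite !gt_eqF.
Qed.
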